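(* For any simple graph $G$ with at least one edge and chromatic number $\chi(G)$, \[ {\rm La}(n,P(G))\leq\left(1+\sqrt{1-\frac{1}{\chi(G)-1}}+o(1)\right)\binom{n}{\lfloor n/2\rfloor}, \] where $o(1)\to0$ as $n\to\infty$. In particular, if $G$ is bipartite, then ${\rm La}(n,P(G))=(1+o(1))\binom{n}{\lfloor n/2\rfloor}$.
   Context: A poset $(S,\leq)$ contains a poset $(S',\leq')$ if there is an injection $f\colon S'\to S$ such that $u\leq' v$ implies $f(u)\leq f(v)$ (copies need not be induced). For a poset $H$, a family $\mathcal{F}\subseteq 2^{[n]}$ is $H$-free if $(\mathcal{F},\subseteq)$ does not contain $H$, and ${\rm La}(n,H)$ is the maximum size of an $H$-free family of subsets of $[n]$. For a simple graph $G=(V,E)$, $P(G)$ is the poset on $V\cup E$ in which $v<e$ exactly when vertex $v$ is an endpoint of edge $e$, with no other relations. *)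

(* Defs.v *)
From HB Require Import structures.
From mathcomp Require Import all_boot all_order.
From mathcomp Require Import boolp.

Set Implicit Arguments.
Unset Strict Implicit.
Unset Printing Implicit Defensive.

Import Order.TTheory Order.DefaultSetSubsetOrder.

Record sgraph := SGraph {
  vertex :> finType;
  adj : rel vertex;
  adj_sym : symmetric adj;
  adj_irrefl : irreflexive adj
}.

Definition edges (G : sgraph) : {set {set G}} :=
  [set [set p.1; p.2] | p : G * G & adj p.1 p.2].

Definition proper_coloring (G : sgraph) (k : nat) (c : G -> 'I_k) : Prop :=
  forall x y : G, adj x y -> c x != c y.

Definition colorable (G : sgraph) (k : nat) : Prop :=
  exists c : G -> 'I_k, proper_coloring c.

Fact colorable_ex (G : sgraph) : exists k, `[< colorable G k >].
Proof.
exists #|G|; apply/asboolP; exists enum_rank => x y xy.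
by rewrite (inj_eq enum_rank_inj); apply: contraTneq xy => ->; rewrite adj_irrefl.
Qed.

Definition chromatic_number (G : sgraph) : nat := ex_minn (colorable_ex G).

Definition bipartite (G : sgraph) : Prop :=
  exists A : {set G}, forall x y : G, adj x y -> (x \in A) != (y \in A).

(* P(G): the type V + E ordered by incidence; the order relation is the
   reflexive closure of [incidence_lt]. *)
Definition incidence_poset (G : sgraph) : Type :=
  (G + {A : {set G} | A \in edges G})%type.

HB.instance Definition _ (G : sgraph) := Finite.on (incidence_poset G).

Definition incidence_lt (G : sgraph) : rel (incidence_poset G) :=
  fun u w => match u, w with inl v, inr e => v \in val e | _, _ => false end.

Fact incidence_lt_irr (G : sgraph) : irreflexive (@incidence_lt G).
Proof. by case. Qed.

Fact incidence_lt_trans (G : sgraph) : transitive (@incidence_lt G).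
Proof. by move=> [?|?] [?|?] [?|?]. Qed.

Fact incidence_display : Order.disp_t. Proof. exact: (Order.Disp tt tt). Qed.

HB.instance Definition _ (G : sgraph) :=
  Order.Lt_isPOrder.Build incidence_display (incidence_poset G)
    (@incidence_lt_irr G) (@incidence_lt_trans G).

Definition poset_contains (d d' : Order.disp_t)
    (S : porderType d) (S' : porderType d') : Prop :=
  exists2 f : S' -> S, injective f & {homo f : u v / (u <= v)%O}.

(* (F, \subset), with the order on {set _} of [Order.DefaultSetSubsetOrder]. *)
Definition family_poset (n : nat) (F : {set {set 'I_n}}) : Type :=
  {A : {set 'I_n} | A \in F}.

HB.instance Definition _ (n : nat) (F : {set {set 'I_n}}) :=
  SubChoice.on (family_poset F).
HB.instance Definition _ (n : nat) (F : {set {set 'I_n}}) :=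
  [SubChoice_isSubPOrder of family_poset F by <:
     with Order.SetSubsetOrder.subset_display].

Definition poset_free (d : Order.disp_t) (H : porderType d) (n : nat)
    (F : {set {set 'I_n}}) : Prop :=
  ~ poset_contains (family_poset F) H.

(* If H is empty, no family is H-free and this is 0. *)
Definition La (d : Order.disp_t) (n : nat) (H : porderType d) : nat :=
  \max_(F : {set {set 'I_n}} | `[< poset_free H F >]) #|F|.

(* Main.v *)
(** Average over a uniformly random maximal chain of subsets of [n].  If [F] is
    free of P(G), then for every set [M] either fewer than |V| + |E| members of
    [F] lie strictly below [M], in which case [M] is called low, or fewer than
    that lie strictly above it: otherwise the vertices of [G] can be placed
    below [M] and the edges above it.  Along a maximal chain the low sets come
    first.  A member of [F] on the chain is either the last low set, or the
    first non-low set, or followed by a low set, or preceded by a non-low set.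
    For families near the middle level the last two cases have probability
    o(1), so that the Lubell mass of [F] is at most 1 + p + o(1), where p is the
    probability that both the last low set [A] and the first non-low set
    [B = A + x] lie in [F].  By Cauchy-Schwarz, p^2 is at most the probability
    that [B], [B - x] and [B - y] lie in [F] in this way for two random elements
    x, y of [B].  This is an edge density in the graphs {x, y} |-> S + x + y on
    {x : S + x in F}, which do not contain [G], so by the theorem of Erdos and
    Stone it is at most 1 - 1 / (chi(G) - 1) + o(1).

    The expectation of a sum over the consecutive pairs of a random maximal
    chain is a weighted sum over the pairs (S, S + x), so that the averaging is
    a double counting of such pairs. *)
Require Import Defs.
(* [all_boot] comes second because [all_classical] shadows names of [finset]. *)
From mathcomp Require Import all_classical all_reals all_analysis.
From mathcomp Require Import all_boot all_order all_algebra.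
From mathcomp Require Import ring lra zify.

Set Implicit Arguments.
Unset Strict Implicit.
Unset Printing Implicit Defensive.

Import Order.TTheory GRing.Theory Num.Theory.
Import numFieldNormedType.Exports.

Local Open Scope ring_scope.

(** * The Erdos-Stone theorem by homomorphism counting *)

Lemma weighted_cauchy_schwarz (R : realDomainType) (I : finType) (P : pred I)
    (w a b : I -> R) :
    (forall i, P i -> 0 <= w i) ->
  (\sum_(i | P i) w i * (a i * b i)) ^+ 2 <=
  (\sum_(i | P i) w i * a i ^+ 2) * (\sum_(i | P i) w i * b i ^+ 2).
Proof.
move=> w0; rewrite -subr_ge0 -(pmulrn_lge0 _ (ltn0Sn 1)).
have lagrange_ge0 : 0 <=
    \sum_(i | P i) \sum_(j | P j) w i * w j * (a i * b j - a j * b i) ^+ 2.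
  apply: sumr_ge0 => i Pi; apply: sumr_ge0 => j Pj.
  exact: mulr_ge0 (mulr_ge0 (w0 i Pi) (w0 j Pj)) (sqr_ge0 _).
set sa := \sum_(i | P i) w i * a i ^+ 2.
set sb := \sum_(i | P i) w i * b i ^+ 2.
set sab := \sum_(i | P i) w i * (a i * b i).
suff <- : \sum_(i | P i) \sum_(j | P j)
    w i * w j * (a i * b j - a j * b i) ^+ 2 = (sa * sb - sab ^+ 2) *+ 2 by [].
transitivity (sa * sb + sb * sa - (sab * sab) *+ 2); last by ring.
rewrite !big_distrlr /= -big_split -sumrMnl -sumrB; apply: eq_bigr => i _ /=.
by rewrite -big_split -sumrMnl -sumrB; apply: eq_bigr => j _ /=; ring.
Qed.

Section UniformProbability.
Variable R : realFieldType.
Implicit Types T U : finType.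

Definition mean T (f : T -> R) : R := (\sum_x f x) / #|T|%:R.

Definition prob T (P : pred T) : R := mean (fun x => (P x)%:R).

Lemma eq_mean T (f g : T -> R) : f =1 g -> mean f = mean g.
Proof. by move=> fg; congr (_ / _); apply: eq_bigr => x _. Qed.

Lemma mean_const T (a : R) : (0 < #|T|)%N -> mean (fun _ : T => a) = a.
Proof.
move=> T0; rewrite /mean sumr_const -[a *+ _]mulr_natr mulfK //.
by rewrite pnatr_eq0 -lt0n.
Qed.

Lemma ler_mean T (f g : T -> R) : (forall x, f x <= g x) -> mean f <= mean g.
Proof. by move=> fg; rewrite ler_wpM2r ?invr_ge0 ?ler_sum. Qed.

Lemma meanD T (f g : T -> R) : mean (fun x => f x + g x) = mean f + mean g.
Proof. by rewrite /mean big_split mulrDl. Qed.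

Lemma meanZl T (a : R) (f : T -> R) : mean (fun x => a * f x) = a * mean f.
Proof. by rewrite /mean -mulr_sumr mulrA. Qed.

Lemma mean_sum T (J : finType) (P : pred J) (f : J -> T -> R) :
  mean (fun x => \sum_(j | P j) f j x) = \sum_(j | P j) mean (f j).
Proof. by rewrite /mean exchange_big -mulr_suml. Qed.

Lemma mean_pair T U (f : T * U -> R) :
  mean f = mean (fun x => mean (fun y => f (x, y))).
Proof.
rewrite /mean -mulr_suml pair_big card_prod natrM invfM [in LHS]mulrA.
rewrite [RHS]mulrAC /=.
by congr (_ * _ * _); apply: eq_bigr => -[].
Qed.

Lemma mean_reindex T (h : T -> T) (f : T -> R) :
  injective h -> mean (fun x => f (h x)) = mean f.
Proof. by move=> hI; rewrite /mean [in RHS](reindex_inj hI). Qed.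

Lemma mean_cauchy_schwarz T (f g : T -> R) :
  mean (fun x => f x * g x) ^+ 2 <=
  mean (fun x => f x ^+ 2) * mean (fun x => g x ^+ 2).
Proof.
rewrite /mean exprMn [leRHS]mulrACA -[leRHS]/(_ * _ ^+ 2).
apply: ler_wpM2r; first exact: sqr_ge0.
have unweighted h : \sum_(x : T) 1 * h x = \sum_x h x :> R.
  by apply: eq_bigr => x _; rewrite mul1r.
have := @weighted_cauchy_schwarz R T predT (fun=> 1) f g (fun _ _ => ler01).
by rewrite /= !unweighted.
Qed.

Lemma prob_ge0 T (P : pred T) : 0 <= prob P.
Proof. by rewrite divr_ge0 ?sumr_ge0. Qed.

Lemma ler_prob T (P Q : pred T) : (forall x, P x -> Q x) -> prob P <= prob Q.
Proof.
move=> PQ; apply: ler_mean => x; rewrite ler_nat.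
by case: (P x) (PQ x) => // ->.
Qed.

Lemma probT T : (0 < #|T|)%N -> prob (@predT T) = 1.
Proof. exact: mean_const. Qed.

Lemma probE T (P : pred T) : prob P = #|[set x | P x]|%:R / #|T|%:R.
Proof.
rewrite /prob /mean -natr_sum -sum1_card [in RHS]big_mkcond /=.
by congr (_%:R / _); apply: eq_bigr => x _; rewrite inE; case: (P x).
Qed.

Lemma prob_lt_exists T (P Q : pred T) :
  prob P < prob Q -> exists x, Q x && ~~ P x.
Proof.
move=> PQ; apply/existsP; apply: contraTT PQ; rewrite negb_exists -leNgt.
move=> /forallP noQ; apply: ler_prob => x Qx.
by have := noQ x; rewrite Qx negbK.
Qed.

End UniformProbability.

Section Resampling.
Variables (R : realFieldType) (V I : finType).
Hypothesis V_gt0 : (0 < #|V|)%N.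
Implicit Types (w : {ffun I -> V}) (i j : I).

Definition update w i v : {ffun I -> V} :=
  [ffun k => if k == i then v else w k].

Lemma update_same w i v : update w i v i = v.
Proof. by rewrite ffunE eqxx. Qed.

Lemma update_other w i v k : k != i -> update w i v k = w k.
Proof. by rewrite ffunE => /negbTE ->. Qed.

Lemma updateC w i j u v :
  i != j -> update (update w i u) j v = update (update w j v) i u.
Proof.
move=> ij; apply/ffunP => k; rewrite !ffunE.
by case: (eqVneq k i) => [->|//]; rewrite (negbTE ij).
Qed.

Lemma update_update w i u v : update (update w i u) i v = update w i v.
Proof. by apply/ffunP => k; rewrite !ffunE; case: (k == i). Qed.

Lemma update_id w i : update w i (w i) = w.
Proof. by apply/ffunP => k; rewrite !ffunE; case: eqP => [->|]. Qed.

Lemma mean_update (h : {ffun I -> V} -> R) i :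
  mean h = mean (fun w => mean (fun v => h (update w i v))).
Proof.
pose exchange (p : {ffun I -> V} * V) := (update p.1 i p.2, p.1 i).
have exchangeK : involutive exchange.
  by case=> w v; rewrite /exchange /= update_same update_update update_id.
transitivity (mean (fun p : {ffun I -> V} * V => h p.1)).
  by rewrite mean_pair; apply: eq_mean => w /=; rewrite mean_const.
by rewrite -(mean_reindex _ (inv_inj exchangeK)) mean_pair.
Qed.

(* Given the coordinates other than [i] and [j], [w j] is an independent copy
   of [w i]: the first factor on the right is the second moment of the
   conditional probability of [f]. *)
Lemma prob_sqr_le_copy (f g : pred {ffun I -> V}) i j : i != j ->
    (forall w v, f (update w j v) = f w) ->
    (forall w v, g (update w i v) = g w) ->
    (forall w, f w -> g w) ->
  prob R f ^+ 2 <= prob R (fun w => f w && f (update w i (w j))) * prob R g.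
Proof.
move=> ij fj gi fg.
pose cond w : R := mean (fun v => (f (update w i v))%:R).
have condi w v : cond (update w i v) = cond w.
  by apply: eq_mean => u; rewrite update_update.
have second_moment : prob R (fun w => f w && f (update w i (w j))) =
    mean (fun w => cond w ^+ 2).
  transitivity (mean (fun w => cond w * (f w)%:R)).
    rewrite /prob (mean_update _ j); apply: eq_mean => w.
    rewrite mulrC -meanZl; apply: eq_mean => v.
    by rewrite update_same fj updateC 1?eq_sym // fj -natrM mulnb.
  rewrite (mean_update _ i); apply: eq_mean => w.
  under eq_mean do rewrite condi.
  by rewrite meanZl expr2.
have cond_g w : cond w = cond w * (g w)%:R.
  rewrite mulrC -meanZl; apply: eq_mean => v.
  by case: (boolP (f _)) => [/fg|_]; rewrite ?gi ?mulr0 // => ->; rewrite mul1r.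
have -> : prob R f = mean (fun w => cond w * (g w)%:R).
  by rewrite /prob (mean_update _ i); apply: eq_mean => w; exact: cond_g.
apply: le_trans (mean_cauchy_schwarz _ _) _; rewrite second_moment le_eqVlt.
apply/orP; left; apply/eqP; congr (_ * _); apply: eq_mean => w.
by rewrite -natrX; case: (g w).
Qed.

Lemma prob_two_coordinates (P : rel V) i j : i != j ->
  prob R (fun w : {ffun I -> V} => P (w i) (w j)) =
  prob R (fun p : V * V => P p.1 p.2).
Proof.
move=> ij; rewrite /prob (mean_update _ i) [RHS]mean_pair.
transitivity
  (mean (fun w : {ffun I -> V} => mean (fun u => (P u (w j))%:R) : R)).
  apply: eq_mean => w; apply: eq_mean => u.
  by rewrite update_same update_other // eq_sym.
rewrite (mean_update _ j).
under eq_mean => w do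
  under eq_mean => v do under eq_mean => u do rewrite update_same.
rewrite mean_const; last by rewrite card_ffun expn_gt0 V_gt0.
by rewrite /mean -!mulr_suml exchange_big.
Qed.

Lemma prob_noninjective :
  prob R (fun w : {ffun I -> V} => ~~ injectiveb w) <= (#|I| ^ 2)%:R / #|V|%:R.
Proof.
have collision i j : j != i ->
    prob R (fun w : {ffun I -> V} => w i == w j) = #|V|%:R^-1.
  move=> ij; rewrite (prob_two_coordinates (fun u v => u == v)) 1?eq_sym //.
  rewrite /prob mean_pair -[RHS](@mean_const R V) //.
  apply: eq_mean => u; rewrite /mean (bigD1 u) //= eqxx big1 => [|v].
    by rewrite addr0 mul1r.
  by rewrite eq_sym => /negbTE ->.
apply: le_trans (_ : \sum_i \sum_(j | j != i)
  prob R (fun w : {ffun I -> V} => w i == w j) <= _).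
  under eq_bigr do rewrite -mean_sum.
  rewrite -mean_sum; apply: ler_mean => w.
  case: (boolP (injectiveb w)) => [_|/injectivePn[i [j ij wij]]].
    by do 2![apply: sumr_ge0 => ? _].
  rewrite (bigD1 i) //= (bigD1 j) 1?eq_sym //= wij eqxx -addrA lerDl.
  by rewrite addr_ge0 //; do ?[apply: sumr_ge0 => ? _].
apply: le_trans (_ : \sum_(i : I) \sum_(j : I) #|V|%:R^-1 <= _).
  apply: ler_sum => i _; rewrite [leLHS]big_mkcond; apply: ler_sum => j _.
  by case: ifP => [/collision ->|_]; rewrite ?invr_ge0.
by rewrite !sumr_const -mulrnA mulnn [leRHS]mulr_natl.
Qed.

End Resampling.

Definition turan_density (R : fieldType) (r : nat) : R := 1 - 1 / r%:R.

Lemma turan_density_itv (R : realFieldType) r :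
  (0 < r)%N -> 0 <= turan_density R r <= 1.
Proof.
move=> r0; rewrite /turan_density gerBl divr_ge0 // andbT.
by rewrite subr_ge0 ler_pdivrMr ?ltr0n // mul1r ler1n.
Qed.

Section Multipartite.
Variables (R : realFieldType) (V I : finType) (C : eqType) (col : I -> C).
Variable e : rel V.
Hypothesis e_sym : symmetric e.
Hypothesis V_gt0 : (0 < #|V|)%N.
Implicit Types (w : {ffun I -> V}) (i j : I) (Z W : {set I}).

Definition multipartite Z w :=
  [forall a in Z, forall b in Z, (col a != col b) ==> e (w a) (w b)].

Local Notation probK Z := (prob R (multipartite Z)).

Lemma multipartiteP Z w :
  reflect {in Z &, forall a b, col a != col b -> e (w a) (w b)}
          (multipartite Z w).
Proof.
apply: (iffP forall_inP) => [Zw a b aZ bZ ab | Zw a aZ].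
  by have /forall_inP/(_ b bZ)/implyP := Zw a aZ; apply.
by apply/forall_inP => b bZ; apply/implyP; exact: Zw.
Qed.

Lemma multipartite_update Z w i v :
  i \notin Z -> multipartite Z (update w i v) = multipartite Z w.
Proof.
move=> iZ; have neq_i a : a \in Z -> a != i by apply: contraTneq => ->.
by apply/multipartiteP/multipartiteP => Zw a b aZ bZ ab;
  have := Zw a b aZ bZ ab; rewrite !update_other ?neq_i.
Qed.

Lemma multipartite_sub Z W w :
  Z \subset W -> multipartite W w -> multipartite Z w.
Proof.
move=> /subsetP ZW /multipartiteP Ww.
by apply/multipartiteP => a b /ZW aW /ZW; exact: Ww.
Qed.

Lemma multipartite_setU1 Z w j :
    multipartite Z w -> {in Z, forall b, col j != col b -> e (w j) (w b)} ->
  multipartite (j |: Z) w.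
Proof.
move=> /multipartiteP Zw jZ.
apply/multipartiteP => a b /setU1P[->|aZ] /setU1P[->|bZ]; rewrite ?eqxx //.
- exact: jZ.
- by rewrite e_sym eq_sym; exact: jZ.
- exact: Zw.
Qed.

Lemma prob_multipartite_twin Z i j : i \in Z -> j \notin Z -> col i = col j ->
  probK Z ^+ 2 <= probK (j |: Z).
Proof.
move=> iZ jZ cij; have ij : i != j by apply: contraNneq jZ => <-.
have V_ffun : (0 < #|{ffun I -> V}|)%N by rewrite card_ffun expn_gt0 V_gt0.
rewrite -[leRHS]mulr1 -(probT R V_ffun).
apply: le_trans (prob_sqr_le_copy R V_gt0 (g := predT) ij _ _ _) _ => //.
  by move=> w v; exact: multipartite_update.
rewrite probT // !mulr1; apply: ler_prob => w /andP[Zw /multipartiteP Zcopy].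
apply: multipartite_setU1 => // b bZ cjb.
have := Zcopy i b iZ bZ; rewrite cij update_same update_other; first exact.
by apply: contraNneq cjb => ->; rewrite cij.
Qed.

Lemma prob_multipartite_blowup Z W :
    Z \subset W -> {in W, forall j, exists2 i, i \in Z & col i = col j} ->
  probK Z ^+ (2 ^ #|W :\: Z|) <= probK W.
Proof.
have [k] := ubnP #|W :\: Z|.
elim: k W => // k IHk W; rewrite ltnS => Wk ZW twins.
have [WZ0|[j jWZ]] := set_0Vmem (W :\: Z).
  suff -> : W = Z by rewrite setDv cards0.
  by apply/eqP; rewrite eqEsubset ZW -setD_eq0 WZ0 eqxx.
have /setDP[jW jZ] := jWZ; have [i iZ cij] := twins j jW.
have ZWj : Z \subset W :\ j by rewrite subsetD1 ZW.
have card_WZ : #|W :\: Z| = #|(W :\ j) :\: Z|.+1.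
  by rewrite (cardsD1 j) jWZ !setDDl setUC.
rewrite card_WZ expnSr exprM -[in leRHS](setD1K jW).
apply: le_trans (prob_multipartite_twin (subsetP ZWj _ iZ) _ cij); last first.
  by rewrite !inE eqxx.
apply: lerXn2r; rewrite ?nnegrE ?exprn_ge0 ?prob_ge0 // IHk //.
  by rewrite -card_WZ.
by move=> l /setD1P[_ /twins].
Qed.

Definition replaceable W j i w :=
  multipartite W w && multipartite W (update w i (w j)).

Lemma prob_replaceable W j i : i \in W -> j \notin W ->
  probK W ^+ 2 <= prob R (replaceable W j i) * probK (W :\ i).
Proof.
move=> iW jW; have ij : i != j by apply: contraNneq jW => <-.
apply: (prob_sqr_le_copy R V_gt0 ij) => [w v|w v|w].
- exact: multipartite_update.
- by apply: multipartite_update; rewrite !inE eqxx.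
- by apply: multipartite_sub; rewrite subD1set.
Qed.

(* Unless [w j] extends the clique [w @: W], some [w l] is not adjacent to
   [w j], and then only [w l] may be replaced by [w j]. *)
Lemma sum_replaceable_le W j w : {in W &, injective col} ->
  \sum_(i in W) (replaceable W j i w)%:R <=
  (multipartite W w)%:R + (#|W|%:R - 1) * (multipartite (j |: W) w)%:R :> R.
Proof.
move=> colI; case: (boolP (multipartite W w)) => [Ww|notW]; last first.
  rewrite big1 => [|i _]; last by rewrite /replaceable (negbTE notW).
  suff /negbTE -> : ~~ multipartite (j |: W) w by rewrite mulr0 addr0.
  by apply: contra notW; apply: multipartite_sub; exact: subsetUr.
case: (boolP (multipartite (j |: W) w)) => [_|notjW].
  rewrite mulr1 addrC subrK -sumr_const; apply: ler_sum => i _.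
  by rewrite lern1 leq_b1.
have [l lW not_jl] : exists2 l, l \in W & ~~ e (w j) (w l).
  apply/exists_inP; apply: contraNT notjW.
  rewrite negb_exists_in => /forall_inP jW.
  by apply: multipartite_setU1 => // b /jW; rewrite negbK.
rewrite mulr0 addr0 (bigD1 l) //=.
rewrite big1 ?addr0 ?lern1 ?leq_b1 // => i /andP[iW il].
suff /negbTE -> : ~~ replaceable W j i w by [].
rewrite /replaceable Ww; apply: contra not_jl => /multipartiteP/(_ i l iW lW).
rewrite update_same update_other; last by rewrite eq_sym.
by apply; apply: contra_neq il; exact: colI iW lW.
Qed.

Lemma moon_moser W j (rho : R) :
    {in W &, injective col} -> j \notin W -> 0 <= rho ->
    {in W, forall i, rho * probK (W :\ i) <= probK W} ->
  (#|W|%:R * rho - 1) * probK W <= (#|W|%:R - 1) * probK (j |: W).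
Proof.
move=> colI jW rho0 ratio.
have replaceable_ge i : i \in W -> rho * probK W <= prob R (replaceable W j i).
  move=> iW; have [W0|W0] := eqVneq (probK W) 0.
    by rewrite W0 mulr0 prob_ge0.
  have Wpos : 0 < probK W by rewrite lt_def W0 prob_ge0.
  rewrite -(ler_pM2r Wpos) -mulrA -expr2.
  apply: le_trans (ler_wpM2l rho0 (prob_replaceable iW jW)) _.
  by rewrite mulrCA; apply: ler_wpM2l (ratio i iW); exact: prob_ge0.
rewrite mulrBl mul1r lerBlDl -mulrA mulr_natl -sumr_const.
apply: le_trans (ler_sum _ replaceable_ge) _.
rewrite -mean_sum -meanZl -meanD; apply: ler_mean => w.
exact: sum_replaceable_le.
Qed.

Lemma prob_multipartite1 i : probK [set i] = 1.
Proof.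
rewrite -(@probT R {ffun I -> V}) ?card_ffun ?expn_gt0 ?V_gt0 //.
apply: eq_mean => w; suff -> : multipartite [set i] w by [].
by apply/multipartiteP => a b /set1P -> /set1P ->; rewrite eqxx.
Qed.

Lemma prob_multipartite2 i j : col i != col j ->
  probK [set i; j] = prob R (fun p : V * V => e p.1 p.2).
Proof.
move=> cij; have ij : i != j by apply: contra_neq cij => ->.
rewrite -(prob_two_coordinates R V_gt0 e ij); apply: eq_mean => w; congr _%:R.
congr nat_of_bool; apply/multipartiteP/idP => [|eij a b].
  by move=> /(_ i j (set21 _ _) (set22 _ _)); exact.
by move=> /set2P[]-> /set2P[]->; rewrite ?eqxx // e_sym.
Qed.

Section Supersaturation.
Variables (r : nat) (d : R).
Hypotheses (r_gt0 : (0 < r)%N) (d_ge0 : 0 <= d).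
Hypothesis e_dense :
  turan_density R r + d <= prob R (fun p : V * V => e p.1 p.2).

Lemma prob_multipartite_ratio k W i :
    {in W &, injective col} -> #|W| = k.+2 -> (k < r)%N -> i \in W ->
  (1 - k.+1%:R / r%:R + d) * probK (W :\ i) <= probK W.
Proof.
elim: k W i => [|k IHk] W j colI cW kr jW.
  have /cards1P[i Wj] : #|W :\ j| == 1.
    by move: cW; rewrite (cardsD1 j) jW => -[/eqP].
  have /setD1P[ij iW] : i \in W :\ j by rewrite Wj set11.
  rewrite Wj prob_multipartite1 mulr1 -(setD1K jW) Wj prob_multipartite2 //.
  by rewrite eq_sym; apply: contra_neq ij => /colI; exact.
have cWj : #|W :\ j| = k.+2 by move: cW; rewrite (cardsD1 j) jW => -[].
have colIj : {in W :\ j &, injective col}.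
  by move=> a b /setD1P[_ aW] /setD1P[_ bW]; exact: colI.
have ratio_ge0 : 0 <= 1 - k.+1%:R / r%:R + d.
  by rewrite addr_ge0 // subr_ge0 ler_pdivrMr ?ltr0n // mul1r ler_nat ltnW.
have jWj : j \notin W :\ j by rewrite !inE eqxx.
have := moon_moser colIj jWj ratio_ge0 (fun i => IHk _ i colIj cWj (ltnW kr)).
rewrite setD1K // cWj -[k.+2%:R]natr1 addrK => extend.
rewrite -(ler_pM2l (ltr0Sn R k)) mulrA; apply: le_trans extend.
apply: ler_wpM2r; first exact: prob_ge0.
rewrite -subr_ge0; move: k.+1%:R (r%:R^-1) => x y.
by rewrite (_ : _ - _ = d) //; ring.
Qed.

Lemma supersaturation k W :
    {in W &, injective col} -> #|W| = k.+1 -> (k <= r)%N ->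
  d ^+ k <= probK W.
Proof.
elim: k W => [|k IHk] W colI cW kr.
  have /cards1P[i ->] : #|W| == 1 by rewrite cW.
  by rewrite prob_multipartite1.
have [i iW] : exists i, i \in W by apply/card_gt0P; rewrite cW.
have cWi : #|W :\ i| = k.+1 by move: cW; rewrite (cardsD1 i) iW => -[].
apply: le_trans (prob_multipartite_ratio colI cW kr iW).
rewrite exprS; apply: ler_pM; rewrite ?exprn_ge0 //.
  by rewrite lerDr subr_ge0 ler_pdivrMr ?ltr0n // mul1r ler_nat.
by apply: IHk (ltnW kr) => // a b /setD1P[_ aW] /setD1P[_ bW]; exact: colI.
Qed.

End Supersaturation.
End Multipartite.

Lemma erdos_stone (R : archiRealFieldType) (G : sgraph) (r : nat) (d : R) :
    (0 < r)%N -> 0 < d -> colorable G r.+1 ->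
  exists n0 : nat, forall (V : finType) (e : rel V), symmetric e ->
    (n0 <= #|V|)%N ->
    turan_density R r + d <= prob R (fun p : V * V => e p.1 p.2) ->
  exists2 phi : G -> V,
    injective phi & forall x y, adj x y -> e (phi x) (phi y).
Proof.
move=> r0 d0 [c c_proper]; pose I : finType := ('I_r.+1 + G)%type.
(* The left summand indexes a clique with one vertex of each colour, which is
   then blown up by the vertices of [G]. *)
pose col (a : I) : 'I_r.+1 := match a with inl i => i | inr x => c x end.
pose Z : {set I} := [set inl i | i : 'I_r.+1].
pose b := (d ^+ r) ^+ (2 ^ #|[set: I] :\: Z|).
have b0 : 0 < b by rewrite !exprn_gt0.
exists (Num.truncn ((#|I| ^ 2)%:R / b)).+1 => V e e_sym V_large e_dense.
have V0 : (0 < #|V|)%N by exact: leq_trans V_large.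
have ZI : {in Z &, injective col}.
  by move=> _ _ /imsetP[i _ ->] /imsetP[j _ ->] /= ->.
have cZ : #|Z| = r.+1 by rewrite card_imset ?card_ord // => i j [].
have clique_ge := supersaturation e_sym V0 r0 (ltW d0) e_dense ZI cZ (leqnn r).
have blowup_ge : b <= prob R (multipartite col e [set: I]).
  apply: le_trans (prob_multipartite_blowup R e_sym V0 (subsetT Z) _) => [|a _].
    by apply: lerXn2r; rewrite ?nnegrE ?exprn_ge0 ?prob_ge0 ?(ltW d0).
  by exists (inl (col a)) => //; exact: imset_f.
have [w /andP[/multipartiteP wK /negPn/injectiveP w_inj]] :
    exists w : {ffun I -> V}, multipartite col e setT w && ~~ ~~ injectiveb w.
  apply: (@prob_lt_exists R); apply: lt_le_trans blowup_ge.
  apply: le_lt_trans (prob_noninjective R I V0) _.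
  rewrite ltr_pdivrMr ?ltr0n // mulrC -ltr_pdivrMr //.
  by apply: lt_le_trans (truncnS_gt _) _; rewrite ler_nat.
exists (fun x => w (inr x)) => [x y /w_inj[]//|x y xy].
by apply: wK; rewrite ?inE //=; exact: c_proper.
Qed.

(** * Weighted covering pairs of subsets *)

Lemma sumr_indicator (R : pzSemiRingType) (T : finType) (A : {set T})
    (P : pred T) :
  \sum_(x in A) (P x)%:R = #|[set x in A | P x]|%:R :> R.
Proof.
rewrite -sumr_const [RHS](eq_bigl (fun x => (x \in A) && P x)) => [|x].
  by rewrite big_mkcondr; apply: eq_bigr => x _; case: (P x).
by rewrite inE.
Qed.

Lemma sumr_ordered_pairs (R : pzSemiRingType) (T : finType) (X Y : {set T}) :
    X \subset Y ->
  \sum_(x in Y) \sum_(y in Y :\ x) ((x \in X) && (y \in X))%:R =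
  (#|X| * #|X|.-1)%:R :> R.
Proof.
move=> XY; rewrite natrM mulr_natl -sumr_const (big_setID X) (setIidPr XY) /=.
rewrite [X in _ + X]big1 ?addr0 => [|x /setDP[_ /negbTE xX]]; last first.
  by rewrite big1 // => y _; rewrite xX.
apply: eq_bigr => x xX; rewrite sumr_indicator (cardsD1 x X) xX; congr _%:R.
apply: eq_card => y; rewrite !inE.
by case: (boolP (y \in X)) => [/(subsetP XY) ->|_]; rewrite ?andbT ?andbF.
Qed.

Section Covers.
Variables (R : realFieldType) (n : nat).
Implicit Types (A B S : {set 'I_n}) (F : {set {set 'I_n}}) (x y : 'I_n).

Definition level_weight A : R := 'C(n, #|A|)%:R^-1.

Definition lubell F : R := \sum_(A in F) level_weight A.

Lemma leq_card_ord A : (#|A| <= n)%N.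
Proof. by rewrite -[leqRHS]card_ord max_card. Qed.

Lemma card_setC_ord A : #|~: A| = (n - #|A|)%N.
Proof. by rewrite [LHS]cardsCs setCK card_ord. Qed.

Definition level A : 'I_n.+1 := Ordinal (leq_card_ord A : (#|A| < n.+1)%N).

Lemma level_weight_ge0 A : 0 <= level_weight A.
Proof. by rewrite invr_ge0. Qed.

Lemma lubell_ge0 F : 0 <= lubell F.
Proof. by apply: sumr_ge0 => A _; exact: level_weight_ge0. Qed.

Lemma level_weight0 : level_weight set0 = 1.
Proof. by rewrite /level_weight cards0 bin0 invr1. Qed.

Lemma level_weightT : level_weight setT = 1.
Proof. by rewrite /level_weight cardsT card_ord binn invr1. Qed.

Lemma level_weight_setU1 x S : x \notin S ->
  level_weight S / (n - #|S|)%:R = level_weight (x |: S) / #|x |: S|%:R.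
Proof.
move=> xS; rewrite /level_weight cardsU1 xS -!invfM -!natrM; congr (_%:R^-1).
by rewrite mulnC [RHS]mulnC mul_bin_left.
Qed.

Lemma sum_level_weight k : (k <= n)%N ->
  \sum_(A : {set 'I_n} | #|A| == k) level_weight A = 1.
Proof.
move=> kn; rewrite (eq_bigr (fun=> 'C(n, k)%:R^-1)) => [|A /eqP cA]; last first.
  by rewrite /level_weight cA.
rewrite sumr_const -[X in _ *+ X]cardsE card_draws card_ord -[LHS]mulr_natr.
by rewrite mulVf // pnatr_eq0 -lt0n bin_gt0.
Qed.

Lemma sum_level_weight_le (f : {set 'I_n} -> R) lo hi (a : R) : 0 <= a ->
    (forall A, f A <= if (lo <= #|A| <= hi)%N then a else 0) ->
  \sum_A level_weight A * f A <= (hi.+1 - lo)%:R * a.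
Proof.
move=> a0 f_le; rewrite (partition_big level predT) //=.
apply: le_trans (_ : \sum_(k < n.+1) (if (lo <= k <= hi)%N then a else 0) <= _).
  apply: ler_sum => k _; have k_le : (k <= n)%N by rewrite -ltnS.
  rewrite -[leRHS]mul1r -(sum_level_weight k_le) mulr_suml.
  apply: ler_sum => A /eqP levelA.
  by apply: ler_wpM2l; rewrite ?level_weight_ge0 // -levelA; exact: f_le.
rewrite -big_mkcond sumr_const -[leLHS]mulr_natl ler_wpM2r // ler_nat.
rewrite -[leqRHS](size_iota lo) cardE -(size_map val); apply: uniq_leq_size.
  by rewrite map_inj_uniq ?enum_uniq //; exact: val_inj.
move=> x /mapP[k]; rewrite mem_enum unfold_in => lo_k_hi ->.
rewrite mem_iota /=; lia.
Qed.

Lemma cover_shift (g : 'I_n -> {set 'I_n} -> R) :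
  \sum_B level_weight B / #|B|%:R * (\sum_(x in B) g x (B :\ x)) =
  \sum_S level_weight S / (n - #|S|)%:R * (\sum_(x in ~: S) g x S).
Proof.
under eq_bigr do rewrite mulr_sumr; under [RHS]eq_bigr do rewrite mulr_sumr.
rewrite (exchange_big_dep predT) //= [RHS](exchange_big_dep predT) //=.
apply: eq_bigr => x _.
rewrite (reindex_onto (setU [set x]) (fun B => B :\ x)) /=.
  apply: eq_big => [S|S /andP[_ /eqP SE]].
    rewrite setU11 in_setC; apply/eqP/idP => [<-|xS]; first by rewrite setD11.
    exact: setU1K.
  have xS : x \notin S by rewrite -SE setD11.
  by rewrite SE (level_weight_setU1 xS).
by move=> B xB; rewrite setD1K.
Qed.

(* The expected sum of [p A B] over the consecutive pairs of a uniformly random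
   maximal chain: [level_weight S] is the probability that the chain meets [S],
   and it then continues to each of the [n - #|S|] sets [x |: S] equally
   often. *)
Definition cover_sum (p : {set 'I_n} -> {set 'I_n} -> R) : R :=
  \sum_S level_weight S / (n - #|S|)%:R * (\sum_(x in ~: S) p S (x |: S)).

Lemma cover_sum_down p :
  cover_sum p = \sum_B level_weight B / #|B|%:R * (\sum_(x in B) p (B :\ x) B).
Proof.
rewrite /cover_sum -(cover_shift (fun x S => p S (x |: S))).
by apply: eq_bigr => B _; congr (_ * _); apply: eq_bigr => x xB; rewrite setD1K.
Qed.

Lemma ler_cover_sum p q :
    (forall S x, x \notin S -> p S (x |: S) <= q S (x |: S)) ->
  cover_sum p <= cover_sum q.
Proof.
move=> pq; apply: ler_sum => S _; apply: ler_wpM2l.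
  by rewrite divr_ge0 ?level_weight_ge0.
by apply: ler_sum => x; rewrite in_setC; exact: pq.
Qed.

Lemma cover_sumD p q :
  cover_sum (fun A B => p A B + q A B) = cover_sum p + cover_sum q.
Proof.
by rewrite -big_split; apply: eq_bigr => S _ /=; rewrite -mulrDr -big_split.
Qed.

Lemma cover_sumB p q :
  cover_sum (fun A B => p A B - q A B) = cover_sum p - cover_sum q.
Proof. by rewrite -sumrB; apply: eq_bigr => S _ /=; rewrite -mulrBr -sumrB. Qed.

Lemma cover_sum_lower (f : {set 'I_n} -> R) :
  cover_sum (fun A _ => f A) = \sum_A level_weight A * f A - f setT.
Proof.
rewrite /cover_sum (bigD1 setT) // [in RHS](bigD1 setT) //=.
rewrite level_weightT !mul1r setCT big_set0 mulr0 add0r [RHS]addrC addKr.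
apply: eq_bigr => S ST.
rewrite sumr_const -[f S *+ _]mulr_natl mulrA card_setC_ord divfK //.
rewrite pnatr_eq0 subn_eq0 -ltnNge -[ltnRHS]card_ord -cardsT.
by rewrite proper_card ?properT.
Qed.

Lemma cover_sum_upper (f : {set 'I_n} -> R) :
  cover_sum (fun _ B => f B) = \sum_B level_weight B * f B - f set0.
Proof.
rewrite cover_sum_down (bigD1 set0) // [in RHS](bigD1 set0) //=.
rewrite level_weight0 !mul1r big_set0 mulr0 add0r [RHS]addrC addKr.
apply: eq_bigr => B B0.
by rewrite sumr_const -[f B *+ _]mulr_natl mulrA divfK // pnatr_eq0 cards_eq0.
Qed.

Lemma cover_sum_telescope (f : {set 'I_n} -> R) :
  cover_sum (fun A B => f A - f B) = f set0 - f setT.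
Proof. by rewrite cover_sumB cover_sum_lower cover_sum_upper; ring. Qed.

Lemma sum_degree_le (degree size : {set 'I_n} -> nat) lo hi c m :
    (0 < c)%N -> (forall A, degree A <= m)%N ->
    (forall A, (0 < degree A)%N -> (lo <= #|A| <= hi)%N) ->
    (forall A, (lo <= #|A| <= hi)%N -> (c <= size A)%N) ->
  \sum_A level_weight A / (size A)%:R * (degree A)%:R <=
  (hi.+1 - lo)%:R * (m%:R / c%:R).
Proof.
move=> c0 degree_le degree_level size_ge.
under [leLHS]eq_bigr do rewrite -mulrA.
apply: sum_level_weight_le => [|A]; first by rewrite divr_ge0.
case: ifPn => [/size_ge c_le|A_level].
  rewrite mulrC ler_pM ?invr_ge0 ?ler_nat //.
  by rewrite lef_pV2 ?posrE ?ltr0n ?ler_nat; lia.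
suff /eqP -> : degree A == 0 by rewrite mulr0.
by apply: contraNT A_level; rewrite -lt0n => /degree_level.
Qed.

Lemma cover_sum_up_le (P : rel {set 'I_n}) lo hi c m :
    (0 < c)%N -> (hi + c <= n)%N ->
    (forall S x, x \notin S -> P S (x |: S) -> (lo <= #|S| <= hi)%N) ->
    (forall S, (#|[set x in ~: S | P S (x |: S)]| <= m)%N) ->
  cover_sum (fun A B => (P A B)%:R) <= (hi.+1 - lo)%:R * (m%:R / c%:R).
Proof.
move=> c0 hi_c levels degree_le.
rewrite /cover_sum; under eq_bigr do rewrite sumr_indicator.
apply: sum_degree_le => // [S|S]; last by lia.
by case/card_gt0P => x; rewrite !inE => /andP[]; exact: levels.
Qed.

Lemma cover_sum_down_le (P : rel {set 'I_n}) lo hi c m :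
    (0 < c)%N -> (c <= lo)%N ->
    (forall B x, x \in B -> P (B :\ x) B -> (lo <= #|B| <= hi)%N) ->
    (forall B, (#|[set x in B | P (B :\ x) B]| <= m)%N) ->
  cover_sum (fun A B => (P A B)%:R) <= (hi.+1 - lo)%:R * (m%:R / c%:R).
Proof.
move=> c0 c_lo levels degree_le.
rewrite cover_sum_down; under eq_bigr do rewrite sumr_indicator.
apply: sum_degree_le => // [B|B]; last by lia.
by case/card_gt0P => x; rewrite !inE => /andP[]; exact: levels.
Qed.

Lemma lubellE F : lubell F = \sum_A level_weight A * (A \in F)%:R.
Proof.
rewrite /lubell big_mkcond; apply: eq_bigr => A _.
by case: ifP; rewrite ?mulr1 ?mulr0.
Qed.

Definition crossing_covers (D U : {set {set 'I_n}}) : R :=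
  cover_sum (fun A B => ((A \in D) && (B \in U))%:R).

Section Threshold.
Variables (F low : {set {set 'I_n}}).
Hypothesis low_down : forall A B, A \subset B -> B \in low -> A \in low.
Hypotheses (F_n0 : set0 \notin F) (F_nT : setT \notin F).

Definition low_covers : R :=
  cover_sum (fun A B => ((A \in F) && (B \in low))%:R).

Definition high_covers : R :=
  cover_sum (fun A B => ((A \notin low) && (B \in F))%:R).

(* Along a maximal chain the membership in [low] drops at most once, which pays
   for the constant 1. *)
Lemma threshold_charging (f g : {set 'I_n} -> R)
    (p : {set 'I_n} -> {set 'I_n} -> R) :
    f setT = 0 -> g set0 = 0 ->
    (forall A x, x \notin A -> f A + g (x |: A) <=
      p A (x |: A) + ((A \in low)%:R - (x |: A \in low)%:R)) ->
  \sum_A level_weight A * f A + \sum_A level_weight A * g A <= 1 + cover_sum p.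
Proof.
move=> fT g0 charge.
have -> : \sum_A level_weight A * f A + \sum_A level_weight A * g A =
    cover_sum (fun A B => f A + g B).
  by rewrite cover_sumD cover_sum_lower cover_sum_upper fT g0 !subr0.
pose is_low A : R := (A \in low)%:R; pose low_drop A B := is_low A - is_low B.
apply: le_trans (ler_cover_sum (q := fun A B => p A B + low_drop A B) charge) _.
rewrite cover_sumD cover_sum_telescope addrC lerD2r lerBlDr ler_wpDr //.
by rewrite lern1 leq_b1.
Qed.

Lemma low_of_setU1 A x : (x |: A \in low) ==> (A \in low).
Proof. by apply/implyP/low_down/subsetUr. Qed.

Lemma lubell_low : lubell (F :&: low) <= 1 + low_covers.
Proof.
have := threshold_charging (f := fun A => (A \in F :&: low)%:R) (g := fun=> 0)
  (p := fun A B => ((A \in F) && (B \in low))%:R).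
rewrite lubellE [X in _ + X]big1 ?addr0 => [|A _]; last by rewrite mulr0.
apply=> [||A x _]; rewrite ?inE ?(negbTE F_nT) //.
by have := low_of_setU1 A x; do !case: (_ \in _); rewrite //= => _; lra.
Qed.

Lemma lubell_high : lubell (F :\: low) <= 1 + high_covers.
Proof.
have := threshold_charging (f := fun=> 0) (g := fun A => (A \in F :\: low)%:R)
  (p := fun A B => ((A \notin low) && (B \in F))%:R).
rewrite lubellE [X in X + _]big1 ?add0r => [|A _]; last by rewrite mulr0.
apply=> [||A x _]; rewrite ?inE ?(negbTE F_n0) ?andbF //.
by have := low_of_setU1 A x; do !case: (_ \in _); rewrite //= => _; lra.
Qed.

Lemma lubell_threshold :
  lubell F <=
  1 + low_covers + high_covers + crossing_covers (F :&: low) (F :\: low).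
Proof.
have lubell_split : lubell F = lubell (F :&: low) + lubell (F :\: low).
  by rewrite /lubell (big_setID low).
rewrite lubell_split !lubellE /low_covers /high_covers /crossing_covers.
rewrite -!addrA -!cover_sumD.
apply: threshold_charging => [||A x _];
  rewrite ?inE ?(negbTE F_nT) ?(negbTE F_n0) ?andbF //.
by have := low_of_setU1 A x; do !case: (_ \in _); rewrite //= => _; lra.
Qed.

End Threshold.
End Covers.

Section SecondMoment.
Variables (R : realFieldType) (n : nat).
Implicit Types (A B S : {set 'I_n}) (D U : {set {set 'I_n}}) (x y : 'I_n).

Local Notation w := (level_weight R).

Definition link D S : {set 'I_n} := [set x in ~: S | x |: S \in D].

Definition colink D B : {set 'I_n} := [set x in B | B :\ x \in D].

Definition link_pairs D U S : {set 'I_n * 'I_n} :=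
  [set p | [&& p.1 \in link D S, p.2 \in link D S, p.1 != p.2 &
               p.1 |: (p.2 |: S) \in U]].

Lemma leq_card_link_pairs D U S :
  (#|link_pairs D U S| <= #|link D S| * #|link D S|)%N.
Proof.
rewrite -cardsX; apply: subset_leq_card; apply/subsetP => -[x y].
by rewrite in_setX [in X in X -> _]inE => /and4P[-> ->].
Qed.

Lemma double_cover_shift (g : 'I_n -> 'I_n -> {set 'I_n} -> R) :
  \sum_B w B / (#|B| * #|B|.-1)%:R *
    (\sum_(x in B) \sum_(y in B :\ x) g x y (B :\ x :\ y)) =
  \sum_S w S / ((n - #|S|) * (n - #|S|).-1)%:R *
    (\sum_(y in ~: S) \sum_(x in ~: (y |: S)) g x y S).
Proof.
pose inner x S := (\sum_(y in S) g x y (S :\ y)) / #|S|%:R.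
pose outer y S := (\sum_(x in ~: (y |: S)) g x y S) / (n - #|S|).-1%:R.
transitivity (\sum_B w B / #|B|%:R * (\sum_(x in B) inner x (B :\ x))).
  apply: eq_bigr => B _; rewrite natrM invfM mulrA -!mulrA; congr (_ * (_ * _)).
  rewrite mulrC mulr_suml; apply: eq_bigr => x xB.
  by rewrite /inner (cardsD1 x B) xB.
transitivity (\sum_S w S / (n - #|S|)%:R * (\sum_(y in ~: S) outer y S));
  last first.
  apply: eq_bigr => S _; rewrite natrM invfM mulrA -!mulrA; congr (_ * (_ * _)).
  by rewrite mulrC mulr_suml.
rewrite cover_shift -[RHS]cover_shift; apply: eq_bigr => S _.
rewrite -!mulrA; congr (_ * _); rewrite /inner /outer.
rewrite -mulr_suml mulrA [LHS]mulrC; congr (_ * _).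
rewrite exchange_big mulr_sumr; apply: eq_bigr => y yS /=.
rewrite setD1K // -subn1 -subnDA addn1 mulrC.
by rewrite (cardsD1 y S) yS.
Qed.

Lemma sum_colink_pairs D U :
  \sum_(B in U) w B *
    ((#|colink D B| * #|colink D B|.-1)%:R / (#|B| * #|B|.-1)%:R) =
  \sum_S w S / ((n - #|S|) * (n - #|S|).-1)%:R * #|link_pairs D U S|%:R.
Proof.
pose good x y S : bool := [&& x |: (y |: S) \in U, x |: S \in D & y |: S \in D].
transitivity (\sum_B w B / (#|B| * #|B|.-1)%:R *
  \sum_(x in B) \sum_(y in B :\ x) (good x y (B :\ x :\ y))%:R).
  rewrite big_mkcond; apply: eq_bigr => B _.
  have goodE x y : x \in B -> y \in B :\ x ->
      good x y (B :\ x :\ y) =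
      (B \in U) && ((x \in colink D B) && (y \in colink D B)).
    move=> xB yBx; have [yx yB] := setD1P yBx.
    have setD2C : B :\ x :\ y = B :\ y :\ x by rewrite !setDDl setUC.
    rewrite /good setD1K // setD1K // setD2C.
    rewrite setD1K; last by rewrite !inE eq_sym yx.
    by rewrite !inE xB yB /= [_ && (B :\ x \in D)]andbC.
  case: ifP => BU.
    rewrite mulrAC -mulrA; congr (_ * (_ * _)).
    rewrite -(@sumr_ordered_pairs R _ (colink D B) B).
      by apply: eq_bigr => x xB; apply: eq_bigr => y yBx; rewrite goodE // BU.
    by apply/subsetP => x; rewrite inE => /andP[].
  rewrite big1 ?mulr0 // => x xB; rewrite big1 // => y yBx.
  by rewrite goodE // BU.
rewrite (double_cover_shift (fun x y S => (good x y S)%:R)).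
apply: eq_bigr => S _; congr (_ * _).
have -> : #|link_pairs D U S|%:R =
    \sum_y \sum_x ((x, y) \in link_pairs D U S)%:R :> R.
  rewrite exchange_big pair_big -sumr_const big_mkcond /=.
  by apply: eq_bigr => -[x y] _; case: ifP.
rewrite big_mkcond; apply: eq_bigr => y _; case: ifPn => [yS|yS].
  rewrite big_mkcond; apply: eq_bigr => x _.
  move: yS; rewrite !inE /good /= => ->.
  by case: (x == y); case: (x \in S); rewrite /= ?andbF // andbC -andbA.
rewrite big1 // => x _; move: yS; rewrite !inE => /negbTE -> /=.
by rewrite andbF.
Qed.

Lemma sqr_ratio_le (k b : nat) : (1 < b)%N -> (k <= b)%N ->
  (k%:R / b%:R) ^+ 2 <= b%:R^-1 + (k * k.-1)%:R / (b * b.-1)%:R :> R.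
Proof.
move=> b_gt1 kb; have b_gt0 : 0 < b%:R :> R by rewrite ltr0n; lia.
have -> : (k%:R / b%:R) ^+ 2 =
    k%:R / b%:R * b%:R^-1 + (k * k.-1)%:R / (b * b)%:R :> R.
  case: k {kb} => [|k]; first by rewrite !mul0r expr0n addr0.
  by rewrite !natrM -natr1 /=; field; rewrite gt_eqF.
apply: lerD.
  by rewrite ler_piMl ?invr_ge0 // ler_pdivrMr // mul1r ler_nat.
rewrite ler_wpM2l // lef_pV2 ?posrE ?ltr0n; [|lia|lia].
by rewrite ler_nat leq_mul ?leq_pred.
Qed.

Lemma crossing_covers_colink D U :
  crossing_covers R D U = \sum_(B in U) w B * (#|colink D B|%:R / #|B|%:R).
Proof.
rewrite /crossing_covers cover_sum_down [RHS]big_mkcond; apply: eq_bigr => B _.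
case: ifP => BU; last by rewrite big1 ?mulr0 // => x _; rewrite andbF.
under eq_bigr do rewrite andbT.
by rewrite sumr_indicator mulrAC -mulrA.
Qed.

Lemma crossing_covers_ge0 D U : 0 <= crossing_covers R D U.
Proof.
rewrite crossing_covers_colink; apply: sumr_ge0 => B _.
by rewrite mulr_ge0 ?divr_ge0 ?level_weight_ge0.
Qed.

Lemma crossing_covers_sqr_le_moment D U :
  crossing_covers R D U ^+ 2 <=
  lubell R U * (\sum_(B in U) w B * (#|colink D B|%:R / #|B|%:R) ^+ 2).
Proof.
pose ratio B : R := #|colink D B|%:R / #|B|%:R.
have := weighted_cauchy_schwarz (fun=> 1) ratio
  (fun B (_ : B \in U) => level_weight_ge0 R B).
rewrite crossing_covers_colink /lubell.
under eq_bigr do rewrite mul1r; move=> /le_trans; apply.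
by under eq_bigr do rewrite expr1n mulr1.
Qed.

Lemma sum_link D : set0 \notin D ->
  \sum_S w S / (n - #|S|)%:R * #|link D S|%:R = lubell R D.
Proof.
move=> /negbTE D0; have := cover_sum_upper (fun B => (B \in D)%:R : R).
rewrite D0 subr0 -lubellE => <-.
by apply: eq_bigr => S _; rewrite sumr_indicator.
Qed.

Lemma moment_le D U c : (1 < c)%N -> {in U, forall B, (c <= #|B|)%N} ->
  \sum_(B in U) w B * (#|colink D B|%:R / #|B|%:R) ^+ 2 <=
  lubell R U / c%:R +
  \sum_S w S / ((n - #|S|) * (n - #|S|).-1)%:R * #|link_pairs D U S|%:R.
Proof.
move=> c_gt1 U_ge; rewrite -sum_colink_pairs mulr_suml -big_split /=.
apply: ler_sum => B BU; have B_ge := U_ge B BU.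
rewrite -mulrDr ler_wpM2l ?level_weight_ge0 //.
apply: le_trans (sqr_ratio_le (leq_trans c_gt1 B_ge) _) _.
  by apply: subset_leq_card; apply/subsetP => x; rewrite inE => /andP[].
by rewrite lerD2r lef_pV2 ?posrE ?ltr0n ?ler_nat //; lia.
Qed.

Section SparseLinks.
Variables (D : {set {set 'I_n}}) (c : nat) (a b : R).
Hypotheses (c_gt1 : (1 < c)%N) (a_ge0 : 0 <= a) (b_ge0 : 0 <= b).
Hypotheses (D_n0 : set0 \notin D) (D_le : {in D, forall A, (#|A| + c <= n)%N}).

Let rho : R := a * (1 + c%:R^-1) + b / c%:R.

Lemma link_pairs_weight_le U S :
    #|link_pairs D U S|%:R <= a * #|link D S|%:R ^+ 2 + b * #|link D S|%:R ->
  #|link_pairs D U S|%:R / ((n - #|S|) * (n - #|S|).-1)%:R <=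
  rho * (#|link D S|%:R / (n - #|S|)%:R).
Proof.
have [->|[x]] := set_0Vmem (link D S).
  rewrite cards0 expr0n /= !mulr0 addr0 !mul0r mulr0 lern0 => /eqP ->.
  by rewrite mul0r.
rewrite !inE => /andP[xS xD] sparse.
have := D_le xD; rewrite cardsU1 xS => S_le.
have link_le : (#|link D S| <= n - #|S|)%N.
  rewrite -card_setC_ord; apply: subset_leq_card.
  by apply/subsetP => z; rewrite inE => /andP[].
have [k n_S] : exists k, (n - #|S|)%N = k.+1 by exists (n - #|S|).-1; lia.
have ck : (c <= k)%N by lia.
rewrite n_S /= in link_le *; set u : R := #|link D S|%:R in sparse *.
have k_gt0 : 0 < k%:R :> R by rewrite ltr0n; lia.
have kV_le : k%:R^-1 <= c%:R^-1 :> R.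
  by rewrite lef_pV2 ?posrE ?ler_nat // ltr0n ltnW.
apply: le_trans (ler_wpM2r _ sparse) _; first by rewrite invr_ge0.
have -> : (a * u ^+ 2 + b * u) / (k.+1 * k)%:R =
    (a * (u / k%:R) + b / k%:R) * (u / k.+1%:R).
  by rewrite natrM; field; rewrite nat1r !gt_eqF.
apply: ler_wpM2r; first by rewrite divr_ge0.
apply: lerD; apply: ler_wpM2l => //.
apply: le_trans (_ : k.+1%:R / k%:R <= _).
  by rewrite ler_pM2r ?invr_gt0 ?ler_nat.
by rewrite -natr1 mulrDl divff ?gt_eqF // mul1r lerD2l.
Qed.

Lemma crossing_covers_sqr_le U : {in U, forall B, (c <= #|B|)%N} ->
    (forall S, #|link_pairs D U S|%:R <=
      a * #|link D S|%:R ^+ 2 + b * #|link D S|%:R) ->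
  crossing_covers R D U ^+ 2 <=
  lubell R U * (lubell R U / c%:R + rho * lubell R D).
Proof.
move=> U_ge sparse; apply: le_trans (crossing_covers_sqr_le_moment D U) _.
apply: ler_wpM2l; first exact: lubell_ge0.
apply: le_trans (moment_le D c_gt1 U_ge) _.
rewrite lerD2l -(sum_link D_n0) mulr_sumr; apply: ler_sum => S _.
rewrite -!mulrA [leRHS]mulrCA ler_wpM2l ?level_weight_ge0 //.
rewrite [leLHS]mulrC [(n - _)%:R^-1 * _]mulrC; exact: link_pairs_weight_le.
Qed.

End SparseLinks.
End SecondMoment.

(** * Families that do not contain P(G) *)

Lemma edge_exists G : edges G != set0 -> exists x y : G, adj x y.
Proof.
by case/set0Pn => A /imsetP[[x y]]; rewrite inE /= => xy _; exists x, y.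
Qed.

Lemma colorable_chromatic G : colorable G (chromatic_number G).
Proof. by rewrite /chromatic_number; case: ex_minnP => k /asboolP. Qed.

Lemma chromatic_number_gt1 G : edges G != set0 -> (1 < chromatic_number G)%N.
Proof.
move=> /edge_exists[x [y xy]]; have [c /(_ x y xy)] := colorable_chromatic G.
case: (chromatic_number G) c => [|[|k]] c //; first by case: (c x).
by rewrite !ord1.
Qed.

Lemma bipartite_colorable G : bipartite G -> colorable G 2.
Proof.
case=> A A_cut; exists (fun x => if x \in A then ord0 else ord_max) => x y.
by move/A_cut; case: (x \in A); case: (y \in A).
Qed.

Lemma exists_injection (T U : finType) (X : {set U}) : (#|T| <= #|X|)%N ->
  exists2 f : T -> U, injective f & forall x, f x \in X.
Proof.
move=> TX; exists (fun x => enum_val (widen_ord TX (enum_rank x))).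
  by move=> x y /enum_val_inj/(congr1 val) /= /val_inj/enum_rank_inj.
by move=> x; exact: enum_valP.
Qed.

Lemma poset_free_sub (d : Order.disp_t) (H : porderType d) n
    (F F' : {set {set 'I_n}}) :
  F' \subset F -> poset_free H F -> poset_free H F'.
Proof.
move=> /subsetP F'F Ffree [f f_inj f_homo]; apply: Ffree.
exists (fun u => Sub (val (f u)) (F'F _ (valP (f u))) : family_poset F).
  by move=> u v /(congr1 val) /= /val_inj/f_inj.
by move=> u v /f_homo.
Qed.

Lemma La_le (R : numDomainType) (d : Order.disp_t) n (H : porderType d)
    (b : R) :
    0 <= b -> (forall F : {set {set 'I_n}}, poset_free H F -> #|F|%:R <= b) ->
  (La n H)%:R <= b.
Proof.
move=> b0 F_le; rewrite /La; elim/big_ind: _ => // [x y xb yb|F /asboolP].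
  by case: (leqP x y).
exact: F_le.
Qed.

Lemma leq_bin_half_La G n :
  edges G != set0 -> ('C(n, n./2) <= La n (incidence_poset G))%N.
Proof.
move=> /edge_exists[x [y xy]].
pose F : {set {set 'I_n}} := [set A : {set 'I_n} | #|A| == n./2].
rewrite -[n in 'C(n, _)]card_ord -card_draws.
apply: (@leq_bigmax_cond _ _ (fun F : {set {set 'I_n}} => #|F|) F).
apply/asboolP => -[f f_inj f_homo].
have xy_edge : [set x; y] \in edges G.
  by apply/imsetP; exists (x, y); rewrite ?inE.
pose u : incidence_poset G := inl x.
pose v : incidence_poset G := inr (exist (fun A => A \in edges G) _ xy_edge).
have uv : (u < v)%O by rewrite /Order.lt /=; exact: set21.
have fuv : val (f u) \subset val (f v) := f_homo u v (ltW uv).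
suff /val_inj/f_inj : val (f u) = val (f v) by [].
apply/eqP; rewrite eqEcard fuv /=.
by have := valP (f u); have := valP (f v); rewrite !inE => /eqP -> /eqP ->.
Qed.

Section IncidenceFree.
Variables (G : sgraph) (n : nat) (F : {set {set 'I_n}}).
Hypothesis F_free : poset_free (incidence_poset G) F.

Lemma no_incidence_embedding (g : incidence_poset G -> {set 'I_n}) :
    injective g -> (forall u, g u \in F) ->
  ~ (forall u v, incidence_lt u v -> g u \subset g v).
Proof.
move=> g_inj gF g_homo; apply: F_free.
exists (fun u => Sub (g u) (gF u) : family_poset F).
  by move=> u v /(congr1 val) /= /g_inj.
by move=> u v; rewrite le_eqVlt => /predU1P[->|/g_homo].
Qed.

Definition incidence_size : nat := #|G| + #|edges G|.

Lemma few_below_or_above (M : {set 'I_n}) :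
  (#|[set A in F | A \proper M]| < incidence_size)%N ||
  (#|[set B in F | M \proper B]| < incidence_size)%N.
Proof.
rewrite -[_ || _]negbK negb_or -!leqNgt.
apply/negP => /andP[many_below many_above].
have [f f_inj f_below] : exists2 f : G -> {set 'I_n}, injective f &
    forall x, f x \in [set A in F | A \proper M].
  exact: exists_injection (leq_trans (leq_addr _ _) many_below).
have [h h_inj h_above] : exists2 h : {A | A \in edges G} -> {set 'I_n},
    injective h & forall a, h a \in [set B in F | M \proper B].
  apply: exists_injection; apply: leq_trans many_above.
  by rewrite card_sig; exact: leq_addl.
have {}f_below x : f x \in F /\ f x \proper M.
  by apply/andP; have := f_below x; rewrite inE.
have {}h_above a : h a \in F /\ M \proper h a.
  by apply/andP; have := h_above a; rewrite inE.
have fh x a : f x \proper h a := proper_trans (f_below x).2 (h_above a).2.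
apply: (@no_incidence_embedding
  (fun u => match u with inl x => f x | inr a => h a end)).
- move=> [x|a] [y|b] => [/f_inj-> //|fx_hb|ha_fy|/h_inj-> //].
  + by have := fh x b; rewrite fx_hb properxx.
  + by have := fh y a; rewrite ha_fy properxx.
- by move=> [x|a]; [case: (f_below x)|case: (h_above a)].
- by move=> [x|a] [y|b] // _; exact: proper_sub.
Qed.

Lemma card_edge A : A \in edges G -> #|A| = 2%N.
Proof.
case/imsetP => -[x y]; rewrite inE /= => xy ->; rewrite cards2.
by case: eqVneq xy => // ->; rewrite adj_irrefl.
Qed.

Lemma no_link_embedding (S : {set 'I_n}) (phi : G -> 'I_n) :
    injective phi ->
    (forall x, phi x \notin S) -> (forall x, phi x |: S \in F) ->
  ~ (forall x y, adj x y -> phi x |: (phi y |: S) \in F).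
Proof.
move=> phi_inj phiS phi_vertex phi_edge.
pose ends (u : incidence_poset G) : {set G} :=
  match u with inl x => [set x] | inr a => val a end.
have ends_inj : injective ends.
  move=> [x|a] [y|b] /= => [/set1_inj-> //|x_b|a_y|ab].
  - by have := card_edge (valP b); rewrite /= -x_b cards1.
  - by have := card_edge (valP a); rewrite /= a_y cards1.
  - by congr inr; exact: val_inj.
apply: (@no_incidence_embedding (fun u => phi @: ends u :|: S)).
- move=> u v uv; apply/ends_inj/(imset_inj phi_inj).
  have off_S (X : {set G}) : (phi @: X :|: S) :\: S = phi @: X.
    rewrite setDUl setDv setU0; apply/setDidPl; rewrite disjoint_subset.
    by apply/subsetP => _ /imsetP[x _ ->]; exact: phiS.
  by rewrite -off_S uv off_S.
- move=> [x|a] /=; first by rewrite imset_set1.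
  have /imsetP[[x y]] := valP a; rewrite inE /= => xy ->.
  by rewrite imsetU1 imset_set1 -setUA phi_edge.
- by move=> [x|a] [y|b] //= xb; apply/setSU/imsetS; rewrite sub1set.
Qed.

End IncidenceFree.

Lemma card_sub_pairs (T : finType) (X : {set T}) (e : rel T) :
  #|[set p : {x | x \in X} * {x | x \in X} | e (val p.1) (val p.2)]| =
  #|[set p : T * T | [&& p.1 \in X, p.2 \in X & e p.1 p.2]]|.
Proof.
have val2_inj : injective
    (fun p : {x | x \in X} * {x | x \in X} => (val p.1, val p.2)).
  by move=> [x y] [x' y'] [xx' yy']; congr (_, _); exact: val_inj.
rewrite -(card_imset _ val2_inj); apply: eq_card => -[x y]; rewrite [RHS]inE /=.
apply/imsetP/and3P => [[[x' y']]|[xX yX xy]].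
  by rewrite inE => xy [-> ->]; split; rewrite ?(valP x') ?(valP y').
by exists (exist _ x xX, exist _ y yX); rewrite // inE.
Qed.

Lemma card_link_pairs_le (R : archiRealFieldType) (G : sgraph) (r : nat)
    (d : R) :
    (0 < r)%N -> 0 < d -> colorable G r.+1 ->
  exists n0 : nat, forall n (F D U : {set {set 'I_n}}) (S : {set 'I_n}),
    poset_free (incidence_poset G) F -> D \subset F -> U \subset F ->
    #|link_pairs D U S|%:R <=
    (turan_density R r + d) * #|link D S|%:R ^+ 2 + n0%:R * #|link D S|%:R.
Proof.
move=> r0 d0 Gcol; have [n0 embed] := erdos_stone r0 d0 Gcol.
exists n0 => n F D U S Ffree /subsetP DF /subsetP UF.
have density_ge0 : 0 <= turan_density R r + d.
  by have /andP[? _] := turan_density_itv R r0; rewrite addr_ge0 ?(ltW d0).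
have pairs_le := leq_card_link_pairs D U S.
have [link_small|link_large] := ltnP #|link D S| n0.
  apply: le_trans (_ : (#|link D S| * #|link D S|)%:R <= _).
    by rewrite ler_nat.
  rewrite natrM ler_wpDl ?mulr_ge0 ?exprn_ge0 //.
  by rewrite ler_wpM2r // ler_nat ltnW.
pose V : finType := {x | x \in link D S}.
pose e : rel V := fun x y => (val x != val y) && (val x |: (val y |: S) \in U).
have e_sym : symmetric e by move=> x y; rewrite /e eq_sym setUCA.
have cV : #|V| = #|link D S| by rewrite card_sig; exact: eq_card.
have edges_pairs : #|[set p : V * V | e p.1 p.2]| = #|link_pairs D U S|.
  exact: card_sub_pairs (fun x y => (x != y) && (x |: (y |: S) \in U)).
rewrite leNgt; apply/negP => dense.
have link_gt0 : (0 < #|link D S|)%N.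
  rewrite lt0n; apply: contraTneq dense => link0; rewrite -leNgt link0.
  move: pairs_le; rewrite link0 leqn0 => /eqP ->.
  by rewrite expr0n !mulr0 addr0.
have [||phi phi_inj phi_edge] := embed V e e_sym; first by rewrite cV.
  rewrite probE card_prod cV edges_pairs.
  rewrite ler_pdivlMr ?ltr0n ?muln_gt0 ?link_gt0 //.
  by apply: le_trans (ltW dense); rewrite natrM -expr2 lerDl mulr_ge0.
have phiP x : (val (phi x) \notin S) && (val (phi x) |: S \in D).
  by have := valP (phi x); rewrite !inE.
apply: (no_link_embedding Ffree (phi := fun x => val (phi x)) (S := S)).
- exact: inj_comp val_inj phi_inj.
- by move=> x; case/andP: (phiP x).
- by move=> x; case/andP: (phiP x) => _ /DF.
- by move=> x y /phi_edge/andP[_ /UF].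
Qed.

Section MiddleLubell.
Variables (R : realFieldType) (G : sgraph) (n : nat) (F : {set {set 'I_n}}).
Variables (lo hi c : nat).
Implicit Types (A B S : {set 'I_n}).
Hypothesis F_free : poset_free (incidence_poset G) F.
Hypothesis F_levels : {in F, forall A, (lo <= #|A| <= hi)%N}.
Hypotheses (c_gt1 : (1 < c)%N) (c_lo : (c <= lo)%N) (hi_c : (hi + c <= n)%N).

Let m := incidence_size G.

Definition few_below : {set {set 'I_n}} :=
  [set M : {set 'I_n} | (#|[set A in F | A \proper M]| < m)%N].

Definition cover_error : R := (hi.+1 - lo)%:R * (m%:R / c%:R).

Lemma few_below_down A B : A \subset B -> B \in few_below -> A \in few_below.
Proof.
move=> AB; rewrite !inE; apply: leq_ltn_trans; apply: subset_leq_card.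
by apply/subsetP => X; rewrite !inE => /andP[-> /proper_sub_trans->].
Qed.

Lemma low_covers_le : low_covers R F few_below <= cover_error.
Proof.
rewrite /cover_error -[(hi.+1 - lo)%N]subSS.
apply: (@cover_sum_down_le _ _ (fun A B => (A \in F) && (B \in few_below))).
- exact: ltnW.
- exact: leqW.
- by move=> B x xB /andP[/F_levels B_levels _]; rewrite (cardsD1 x B) xB !ltnS.
- move=> B; have [B_low|B_high] := boolP (B \in few_below); last first.
    by rewrite eq_card0 // => x; rewrite in_set !andbF.
  move: (B_low); rewrite inE => /ltnW; apply: leq_trans.
  rewrite -(card_in_imset (f := fun x => B :\ x)) => [|x y].
    apply: subset_leq_card; apply/subsetP => _ /imsetP[x xB ->]; move: xB.
    by rewrite !inE => /andP[xB /andP[-> _]]; exact: properD1.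
  rewrite !inE => /andP[xB _] _ /setP/(_ x); rewrite !inE eqxx xB andbT.
  by case: eqP.
Qed.

Lemma high_covers_le : high_covers R F few_below <= cover_error.
Proof.
have -> : cover_error = (hi.-1.+1 - lo.-1)%:R * (m%:R / c%:R).
  by rewrite /cover_error; congr (_%:R * _); lia.
apply: (@cover_sum_up_le _ _ (fun A B => (A \notin few_below) && (B \in F))).
- exact: ltnW.
- lia.
- move=> S x xS /andP[_ /F_levels]; rewrite cardsU1 xS /=.
  by move: #|S| => k; lia.
- move=> S; have [S_low|S_high] := boolP (S \in few_below).
    by rewrite eq_card0 // => x; rewrite in_set andbF.
  have := few_below_or_above F_free S; rewrite -/m.
  move: (S_high); rewrite inE => /negbTE-> /ltnW; apply: leq_trans.
  rewrite -(card_in_imset (f := fun x => x |: S)) => [|x y].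
    apply: subset_leq_card; apply/subsetP => _ /imsetP[x xS ->]; move: xS.
    by rewrite !inE => /andP[xS /= ->]; rewrite properUr // sub1set.
  rewrite !inE => /andP[/negbTE xS _] _ /setP/(_ x); rewrite !inE eqxx xS.
  by case: eqP.
Qed.

Lemma lubell_incidence_free_le (a b x : R) : 0 <= a -> 0 <= b -> 0 <= x ->
    c%:R^-1 + (a * (1 + c%:R^-1) + b / c%:R) <= x ^+ 2 ->
    (forall S, #|link_pairs (F :&: few_below) (F :\: few_below) S|%:R <=
      a * #|link (F :&: few_below) S|%:R ^+ 2 +
      b * #|link (F :&: few_below) S|%:R) ->
  lubell R F <= 1 + cover_error *+ 2 + (1 + cover_error) * x.
Proof.
move=> a0 b0 x0; set rho := a * _ + _ => rho_le sparse.
have rho0 : 0 <= rho by rewrite addr_ge0 ?mulr_ge0 ?addr_ge0 ?invr_ge0.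
have err0 : 0 <= cover_error by rewrite !mulr_ge0 ?invr_ge0.
have F_n0 : set0 \notin F by apply/negP => /F_levels; rewrite cards0; lia.
have F_nT : setT \notin F.
  by apply/negP => /F_levels; rewrite cardsT card_ord; lia.
have low_le : lubell R (F :&: few_below) <= 1 + cover_error.
  apply: le_trans (lubell_low R few_below_down F_nT) _.
  by rewrite lerD2l low_covers_le.
have high_le : lubell R (F :\: few_below) <= 1 + cover_error.
  apply: le_trans (lubell_high R few_below_down F_n0) _.
  by rewrite lerD2l high_covers_le.
have crossing_le : crossing_covers R (F :&: few_below) (F :\: few_below) <=
    (1 + cover_error) * x.
  rewrite -ler_sqr ?nnegrE ?crossing_covers_ge0 ?mulr_ge0 ?addr_ge0 // exprMn.
  apply: le_trans (ler_wpM2l (sqr_ge0 _) rho_le).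
  apply: le_trans (crossing_covers_sqr_le c_gt1 a0 b0 _ _ _ sparse) _.
  - by apply: contra F_n0; rewrite inE => /andP[].
  - move=> A; rewrite inE => /andP[/F_levels/andP[_ A_hi] _].
    by apply: leq_trans hi_c; rewrite leq_add2r.
  - move=> B; rewrite inE => /andP[_ /F_levels/andP[B_lo _]].
    exact: leq_trans B_lo.
  rewrite expr2 -mulrA; apply: ler_pM => //; first exact: lubell_ge0.
    by rewrite addr_ge0 ?mulr_ge0 ?lubell_ge0 ?invr_ge0.
  rewrite -/rho [leRHS]mulrDr lerD ?ler_wpM2r ?invr_ge0 // [leRHS]mulrC.
  by rewrite ler_wpM2l.
have := lubell_threshold R few_below_down F_n0 F_nT.
have := low_covers_le; have := high_covers_le; rewrite mulr2n; lra.
Qed.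

End MiddleLubell.

(** * Levels far from the middle *)

Section BinomialDecay.
Local Open Scope nat_scope.

Lemma leq_bin_succ n i : i.*2 < n -> 'C(n, i) <= 'C(n, i.+1).
Proof.
move=> i_half; rewrite -(@leq_pmul2l i.+1) // mul_bin_left leq_mul2r.
by apply/orP; right; lia.
Qed.

Lemma leq_bin_below n i j : i <= j -> j <= n./2 -> 'C(n, i) <= 'C(n, j).
Proof.
move=> /subnK <-; elim: (j - i) => //= k IHk k_half.
by apply: leq_trans (IHk _) (leq_bin_succ _); lia.
Qed.

Lemma leq_bin_half n k : 'C(n, k) <= 'C(n, n./2).
Proof.
have [kn|nk] := leqP k n; last by rewrite bin_small.
have [kh|hk] := leqP k n./2; first exact: leq_bin_below.
by rewrite -bin_sub //; apply: leq_bin_below; lia.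
Qed.

Lemma bin_half_gt0 n : 0 < 'C(n, n./2).
Proof. by rewrite bin_gt0; lia. Qed.

Definition middle_levels n t : {set {set 'I_n}} :=
  [set A : {set 'I_n} | n./2 - t <= #|A| <= n./2 + t].

Lemma card_off_middle_levels n t : t <= n./2 ->
  #|~: middle_levels n t| <= n.+1 * 'C(n, n./2 - t).
Proof.
move=> t_half; rewrite -sum1_card (partition_big (@level n) predT) //=.
rewrite -[n.+1 in leqRHS]card_ord -sum_nat_const.
apply: leq_sum => k _; rewrite sum1_card.
have [k_mid|k_off] := boolP (n./2 - t <= k <= n./2 + t).
  rewrite eq_card0 // => A; apply/negbTE/negP => /andP[].
  rewrite !inE => A_off /eqP levelA; move: A_off.
  by rewrite -[#|A|]/(val (level A)) levelA k_mid.
apply: leq_trans (_ : 'C(n, k) <= _).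
  rewrite -[n in 'C(n, k)]card_ord -card_draws; apply: subset_leq_card.
  by apply/subsetP => A /andP[_ /eqP <-]; rewrite inE.
have k_le_n : k <= n by rewrite -ltnS.
have [k_low|k_high] : k < n./2 - t \/ n./2 + t < k by lia.
  by apply: leq_bin_below; lia.
by rewrite -bin_sub //; apply: leq_bin_below; lia.
Qed.

End BinomialDecay.

Lemma bernoulli_le (R : realDomainType) (x : R) k :
  0 <= x -> 1 + k%:R * x <= (1 + x) ^+ k.
Proof.
move=> x0; elim: k => [|k IHk]; first by rewrite mul0r addr0.
rewrite exprS -natr1.
apply: le_trans (ler_wpM2l _ IHk); last by rewrite addr_ge0.
by rewrite -subr_ge0 (_ : _ - _ = k%:R * x ^+ 2) ?mulr_ge0 ?exprn_ge0 //; ring.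
Qed.

Section BinomialTail.
Variables (R : realFieldType) (n q : nat).
Hypotheses (q_gt0 : (0 < q)%N) (q_le_n : (q <= n)%N).
Let t := (n %/ q)%N.

Lemma bin_ratio_below j : (j + t./2 < n./2)%N ->
  (1 + q%:R^-1) * 'C(n, j)%:R <= 'C(n, j.+1)%:R :> R.
Proof.
move=> j_below; have t_gt0 : (0 < t)%N by rewrite divn_gt0.
have n_lt : (n < t.+1 * q)%N by rewrite -ltn_divLR.
have j_le : (j.+1 <= q * (n - j.*2.+1))%N.
  have t_le : (t <= n - j.*2.+1)%N by lia.
  by apply: leq_trans (leq_mul (leqnn q) t_le); nia.
rewrite -(ler_pM2l (ltr0Sn R j)) -natrM mul_bin_left natrM mulrA.
apply: ler_wpM2r => //; rewrite mulrDr mulr1 -lerBrDl ler_pdivrMr ?ltr0n //.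
by rewrite -natrB -?natrM ?ler_nat; nia.
Qed.

Lemma bin_ratio_below_iter k : (k + t./2 <= t)%N -> (t <= n./2)%N ->
  (1 + q%:R^-1) ^+ k * 'C(n, n./2 - t)%:R <= 'C(n, n./2 - t + k)%:R :> R.
Proof.
elim: k => [|k IHk] k_le t_half; first by rewrite mul1r addn0.
rewrite exprS -mulrA addnS; apply: le_trans (bin_ratio_below _); last by lia.
by apply: ler_wpM2l; [rewrite addr_ge0 ?invr_ge0 | apply: IHk; lia].
Qed.

(* Bernoulli's inequality is squared since the decay has to beat the number
   [n.+1] of levels. *)
Lemma bin_tail_le : (t <= n./2)%N ->
  (1 + (t %/ 4)%:R / q%:R) ^+ 2 * 'C(n, n./2 - t)%:R <= 'C(n, n./2)%:R :> R.
Proof.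
move=> t_half; set a := (t %/ 4)%N.
apply: le_trans (_ : (1 + q%:R^-1) ^+ (a * 2) * 'C(n, n./2 - t)%:R <= _).
  rewrite exprM; apply: ler_wpM2r => //.
  by apply: lerXn2r; rewrite ?nnegrE ?bernoulli_le ?invr_ge0.
apply: le_trans (bin_ratio_below_iter _ t_half) _; first by rewrite /a; lia.
by rewrite ler_nat leq_bin_half.
Qed.

End BinomialTail.

Lemma card_le_lubell (R : realFieldType) n (F : {set {set 'I_n}}) :
  #|F|%:R <= lubell R F * 'C(n, n./2)%:R.
Proof.
rewrite mulr_suml -sumr_const; apply: ler_sum => A _.
rewrite mulrC ler_pdivlMr ?ltr0n ?bin_gt0 ?leq_card_ord //.
by rewrite mul1r ler_nat leq_bin_half.
Qed.

(** * Asymptotics *)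

Lemma cover_error_le (R : realFieldType) (G : sgraph) n q (g : R) :
    (0 < q)%N -> (q <= n)%N -> (7 < n)%N ->
    (48 * incidence_size G)%:R <= g * q%:R ->
  cover_error R G (n./2 - n %/ q) (n./2 + n %/ q) (n %/ 8) <= g.
Proof.
move=> q0 qn n8 q_large; rewrite /cover_error.
set t := (n %/ q)%N; set c := (n %/ 8)%N.
set m := incidence_size G in q_large *.
have c_gt0 : (0 < c)%N by rewrite divn_gt0.
have q_gt0 : 0 < q%:R :> R by rewrite ltr0n.
have levels_le : (q * ((n./2 + t).+1 - (n./2 - t)) <= 48 * c)%N.
  have tq_le : (t * q <= n)%N by exact: leq_divM.
  have n_le : (n <= 16 * c)%N by rewrite /c; lia.
  have t_le : ((n./2 + t).+1 - (n./2 - t) <= 2 * t + 1)%N by lia.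
  by nia.
rewrite mulrA ler_pdivrMr ?ltr0n // -(ler_pM2l q_gt0) -!natrM mulnA.
apply: le_trans (_ : ((48 * c) * m)%:R <= _).
  by rewrite ler_nat leq_mul2r levels_le orbT.
by rewrite mulnAC natrM mulrA [q%:R * g]mulrC ler_wpM2r.
Qed.

Lemma perturbed_density_le (R : rcfType) (tau g b v : R) :
    0 <= tau <= 1 -> 0 <= g <= 1 -> 0 <= v -> (3 + b) * v <= g ^+ 2 ->
  v + ((tau + g ^+ 2) * (1 + v) + b * v) <= (Num.sqrt tau + 2 * g) ^+ 2.
Proof.
move=> /andP[tau0 tau1] /andP[g0 g1] v0 bv_le; set s := Num.sqrt tau.
have -> : (s + 2 * g) ^+ 2 = tau + 4 * (s * g) + 4 * g ^+ 2.
  by rewrite -[tau in RHS]sqr_sqrtr // -/s; ring.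
have g2_le1 : g ^+ 2 <= 1 by rewrite expr_le1.
have sg0 : 0 <= s * g by rewrite mulr_ge0 ?sqrtr_ge0.
have tau_v : (tau + g ^+ 2) * v <= 2 * v by rewrite ler_wpM2r //; lra.
have g2_ge0 := sqr_ge0 g; lra.
Qed.

Lemma perturbed_lubell_le (R : realDomainType) (s g err : R) :
    0 <= s <= 1 -> 0 <= g <= 1 -> err <= g ->
  1 + err *+ 2 + (1 + err) * (s + 2 * g) <= 1 + s + 7 * g.
Proof.
move=> /andP[s0 s1] /andP[g0 g1] err_le.
have err_x : err * (s + 2 * g) <= g * (s + 2 * g).
  by rewrite ler_wpM2r // addr_ge0 ?mulr_ge0.
have gs : g * s <= g by rewrite ler_piMr.
have gg : g * g <= g by rewrite ler_piMr.
by rewrite mulr2n; lra.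
Qed.

Local Open Scope classical_set_scope.
Local Open Scope ring_scope.

Lemma card_off_middle_levels_near (R : realType) (q : nat) (e : R) :
    (1 < q)%N -> 0 < e ->
  \forall n \near \oo,
    #|~: middle_levels n (n %/ q)|%:R <= e * 'C(n, n./2)%:R.
Proof.
move=> q_gt1 e_gt0; have q_gt0 := ltnW q_gt1; near=> n.
have q_le_n : (q <= n)%N by near: n; exact: nbhs_infty_ge.
have t_half : (n %/ q <= n./2)%N by rewrite -divn2 leq_div2l.
apply: le_trans (_ : (n.+1 * 'C(n, n./2 - n %/ q))%:R <= _).
  by rewrite ler_nat card_off_middle_levels.
set a := (n %/ q %/ 4)%N; pose y : R := 1 + a%:R / q%:R.
have y_ge0 : 0 <= y by rewrite addr_ge0 ?divr_ge0.
have q2_gt0 : 0 < (4 * q ^ 2)%:R :> R by rewrite ltr0n muln_gt0 expn_gt0 q_gt0.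
have n_lt : (n < (q * 4) * a.+1)%N.
  by rewrite mulnC -ltn_divLR ?muln_gt0 ?q_gt0 // divnMA.
have qy : q%:R * y = (q + a)%:R.
  by rewrite natrD /y; field; rewrite gt_eqF ?ltr0n.
have n_le : n.+1%:R <= (4 * q ^ 2)%:R * y.
  apply: le_trans (_ : (q * 4)%:R * (q%:R * y) <= _); last first.
    by rewrite mulrA -natrM -mulnn -mulnA mulnCA mulnA.
  by rewrite qy -natrM ler_nat (leq_trans n_lt) // leq_mul2l; lia.
have y_large : (4 * q ^ 2)%:R <= e * y.
  rewrite -(ler_pM2r q2_gt0) -mulrA [y * _]mulrC.
  apply: le_trans (ler_wpM2l (ltW e_gt0) n_le).
  rewrite [leRHS]mulrC -ler_pdivrMr //.
  apply: le_trans (_ : n%:R <= _); last by rewrite ler_nat.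
  by near: n; exact: nbhs_infty_ger.
have tail_le := bin_tail_le R q_gt0 q_le_n t_half.
rewrite natrM; apply: le_trans (ler_wpM2l (ltW e_gt0) tail_le).
rewrite mulrA ler_wpM2r // expr2 mulrA (le_trans n_le) // ler_wpM2r //.
Unshelve. all: by end_near.
Qed.

Lemma middle_lubell_near (R : realType) (G : sgraph) (r : nat) (g : R) :
    (0 < r)%N -> colorable G r.+1 -> 0 < g <= 1 ->
  exists2 q, (1 < q)%N & \forall n \near \oo, forall F : {set {set 'I_n}},
    poset_free (incidence_poset G) F -> F \subset middle_levels n (n %/ q) ->
    lubell R F <= 1 + Num.sqrt (turan_density R r) + 7 * g.
Proof.
move=> r0 Gcol /andP[g0 g1].
have /andP[density0 density1] := turan_density_itv R r0.
set s := Num.sqrt _; have s0 : 0 <= s := sqrtr_ge0 _.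
have s1 : s <= 1 by rewrite -[leRHS]sqrtr1 ler_wsqrtr.
have [n0 pairs_le] := card_link_pairs_le r0 (exprn_gt0 2 g0) Gcol.
pose q := maxn 8 (Num.truncn ((48 * incidence_size G)%:R / g)).+1.
have q8 : (7 < q)%N by exact: leq_maxl.
have q_large : (48 * incidence_size G)%:R <= g * q%:R.
  rewrite -ler_pdivrMl // mulrC (le_trans (ltW (truncnS_gt _))) // ler_nat.
  exact: leq_maxr.
have q_gt1 : (1 < q)%N by exact: leq_trans q8.
exists q => //.
near=> n => F Ffree /subsetP F_mid.
set c := (n %/ 8)%N; set t := (n %/ q)%N in F_mid.
have qn : (q <= n)%N by near: n; exact: nbhs_infty_ge.
have n_ge16 : (15 < n)%N by near: n; exact: nbhs_infty_ge.
have tc : (t <= c)%N by exact: leq_div2l.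
have c_gt1 : (1 < c)%N by rewrite /c; lia.
have c_lo : (c <= n./2 - t)%N by move: tc; rewrite /c; lia.
have hi_c : (n./2 + t + c <= n)%N by move: tc; rewrite /c; lia.
have F_levels : {in F, forall A : {set 'I_n}, (n./2 - t <= #|A| <= n./2 + t)%N}.
  by move=> A /F_mid; rewrite inE.
have c_large : (3 + n0%:R) * c%:R^-1 <= g ^+ 2.
  rewrite ler_pdivrMr ?ltr0n ?(ltnW c_gt1) // mulrC -ler_pdivrMr ?exprn_gt0 //.
  apply: le_trans (ltW (truncnS_gt _)) _; rewrite ler_nat leq_divRL //.
  by near: n; exact: nbhs_infty_ge.
have n_gt7 : (7 < n)%N by exact: leq_trans n_ge16.
have err_le := cover_error_le (ltnW q_gt1) qn n_gt7 q_large.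
rewrite -/t -/c in err_le.
have a0 : 0 <= turan_density R r + g ^+ 2 by rewrite addr_ge0 ?sqr_ge0.
have b0 : 0 <= n0%:R :> R := ler0n R n0.
have x0 : 0 <= s + 2 * g by rewrite addr_ge0 ?mulr_ge0 ?(ltW g0).
apply: le_trans (_ : 1 + cover_error R G _ _ c *+ 2 + _ <= _).
  apply: (lubell_incidence_free_le Ffree F_levels c_gt1 c_lo hi_c a0 b0 x0).
  - by apply: perturbed_density_le; rewrite ?density0 ?g1 ?(ltW g0) ?invr_ge0.
  - by move=> S; apply: pairs_le Ffree _ _; rewrite ?subsetIl ?subsetDl.
by apply: perturbed_lubell_le; rewrite ?s0 ?s1 ?g1 ?(ltW g0).
Unshelve. all: by end_near.
Qed.

Lemma La_incidence_near (R : realType) (G : sgraph) (r : nat) (e : R) :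
    (0 < r)%N -> colorable G r.+1 -> 0 < e ->
  \forall n \near \oo, (La n (incidence_poset G))%:R <=
    (1 + Num.sqrt (turan_density R r) + e) * 'C(n, n./2)%:R.
Proof.
move=> r0 Gcol e0; set s := Num.sqrt _; have s0 : 0 <= s := sqrtr_ge0 _.
pose g := Num.min e 1 / 8.
have [g0 ge g1] : [/\ 0 < g, 8 * g <= e & g <= 1].
  have : Num.min e 1 <= e by rewrite ge_min lexx.
  have : Num.min e 1 <= 1 by rewrite ge_min lexx orbT.
  have : 0 < Num.min e 1 by rewrite lt_min e0 ltr01.
  by rewrite /g; split; lra.
have g01 : 0 < g <= 1 by rewrite g0.
have [q q_gt1 mid_near] := middle_lubell_near r0 Gcol g01.
near=> n.
have mid_le : forall F : {set {set 'I_n}}, poset_free (incidence_poset G) F ->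
    F \subset middle_levels n (n %/ q) -> lubell R F <= 1 + s + 7 * g.
  by near: n.
have off_le : #|~: middle_levels n (n %/ q)|%:R <= g * 'C(n, n./2)%:R.
  by near: n; exact: card_off_middle_levels_near.
set M := middle_levels n (n %/ q) in mid_le off_le.
set C : R := 'C(n, n./2)%:R in off_le *.
apply: La_le => [|F Ffree]; first by rewrite mulr_ge0 // !addr_ge0 // ltW.
have FM_le : #|F :&: M|%:R <= (1 + s + 7 * g) * C.
  apply: le_trans (card_le_lubell _ _) _; rewrite ler_wpM2r //.
  by apply: mid_le (subsetIr F M); exact: poset_free_sub (subsetIl F M) Ffree.
have FD_le : #|F :\: M|%:R <= g * C.
  by apply: le_trans off_le; rewrite ler_nat subset_leq_card // setDE subsetIr.
rewrite -(cardsID M F) natrD; apply: le_trans (lerD FM_le FD_le) _.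
by rewrite -mulrDl ler_wpM2r //; lra.
Unshelve. all: by end_near.
Qed.

Definition La_ratio (R : realFieldType) (G : sgraph) (n : nat) : R :=
  (La n (incidence_poset G))%:R / 'C(n, n./2)%:R.

Lemma La_ratio_near (R : realType) (G : sgraph) (r : nat) (e : R) :
    (0 < r)%N -> colorable G r.+1 -> 0 < e ->
  \forall n \near \oo,
    La_ratio R G n - (1 + Num.sqrt (turan_density R r)) <= e.
Proof.
move=> r0 Gcol e0; near=> n.
rewrite lerBlDl ler_pdivrMr ?ltr0n ?bin_half_gt0 //.
by near: n; exact: La_incidence_near.
Unshelve. all: by end_near.
Qed.

Theorem theorem4 (R : realType) (G : sgraph) (hG : edges G != finset.set0) :
  (exists2 eps : nat -> R, eps @ \oo --> (0 : R) &
     forall n : nat,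
       (La n (incidence_poset G))%:R <=
       (1 + Num.sqrt (1 - 1 / ((chromatic_number G)%:R - 1)) + eps n)
         * 'C(n, n./2)%:R) /\
  (bipartite G ->
     exists2 eps : nat -> R, eps @ \oo --> (0 : R) &
       forall n : nat,
         (La n (incidence_poset G))%:R = (1 + eps n) * 'C(n, n./2)%:R).
Proof.
have C_gt0 n : 0 < 'C(n, n./2)%:R :> R by rewrite ltr0n bin_half_gt0.
split=> [|/bipartite_colorable Gcol].
- have := chromatic_number_gt1 hG; have := colorable_chromatic G.
  case: (chromatic_number G) => // r Gcol r0; rewrite -natr1 addrK.
  set root := Num.sqrt _; pose excess n := La_ratio R G n - (1 + root).
  exists (fun n => Num.max 0 (excess n)) => [|n].
    apply/cvgr0Pnorm_le => e e0; near=> n.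
    rewrite ger0_norm ?le_max ?lexx // ge_max ltW //=.
    by near: n; exact: La_ratio_near.
  by rewrite -ler_pdivrMr // -lerBlDl le_max lexx orbT.
- have root0 : 1 + Num.sqrt (turan_density R 1) = 1.
    by rewrite /turan_density divr1 subrr sqrtr0 addr0.
  exists (fun n => La_ratio R G n - 1) => [|n].
    apply/cvgr0Pnorm_le => e e0; near=> n; rewrite ger0_norm; last first.
      by rewrite subr_ge0 ler_pdivlMr // mul1r ler_nat leq_bin_half_La.
    by rewrite -root0; near: n; exact: La_ratio_near.
  by rewrite addrC subrK divfK ?gt_eqF.
Unshelve. all: by end_near.
Qed.
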